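(* Let $\{R_\lambda\}_{\lambda\in\Lambda}$ be a family of commutative rings with identity, and for each $\lambda\in\Lambda$ let $\pi_\lambda:\prod_{\mu\in\Lambda}R_\mu\to R_\lambda$ be the projection. Then, for each $\lambda\in\Lambda$, the set $\mathcal{M}_\lambda=\{\pi_\lambda^{-1}(M_\lambda): M_\lambda\in\mathrm{Max}(R_\lambda)\}$ is a closed subset of $\mathrm{Max}\left(\prod_{\mu\in\Lambda}R_\mu\right)$, and $\mathrm{Max}(R_\lambda)$ is homeomorphic to $\mathcal{M}_\lambda$ (with the subspace topology).
   Context: For a commutative ring $R$ with identity, $\mathrm{Max}(R)$ is the set of maximal ideals of $R$ with the Zariski (hull-kernel) topology, whose closed sets are the sets $\{M\in\mathrm{Max}(R): S\subseteq M\}$ for $S\subseteq R$. *)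

(* Defs.v *)
From HB Require Import structures.
From mathcomp Require Import all_boot all_order all_algebra.
From mathcomp Require Import all_classical topology.

Set Implicit Arguments.
Unset Strict Implicit.
Unset Printing Implicit Defensive.

Import GRing.Theory.
Local Open Scope classical_set_scope.
Local Open Scope ring_scope.

(* The library only provides the ring structure on non-dependent functions
   [T -> M]; the alias [prodRing R] carries the one on dependent products.
   [comPzRingType] admits the zero ring, and [I] may be empty. *)
Definition prodRing (I : Type) (R : I -> comPzRingType) : Type :=
  forall i, R i.

Section ProdRing.
Context (I : Type) (R : I -> comPzRingType).
Local Notation P := (prodRing R).

HB.instance Definition _ := gen_eqMixin P.
HB.instance Definition _ := gen_choiceMixin P.

Let add (f g : P) : P := fun i => f i + g i.
Let opp (f : P) : P := fun i => - f i.
Let mul (f g : P) : P := fun i => f i * g i.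

Let addA : associative add.
Proof. by move=> f g h; apply: functional_extensionality_dep => i; exact: addrA. Qed.
Let addC : commutative add.
Proof. by move=> f g; apply: functional_extensionality_dep => i; exact: addrC. Qed.
Let add0 : left_id (fun=> 0) add.
Proof. by move=> f; apply: functional_extensionality_dep => i; exact: add0r. Qed.
Let addN : left_inverse (fun=> 0) opp add.
Proof. by move=> f; apply: functional_extensionality_dep => i; exact: addNr. Qed.

HB.instance Definition _ := GRing.isZmodule.Build P addA addC add0 addN.

Let mulA : associative mul.
Proof. by move=> f g h; apply: functional_extensionality_dep => i; exact: mulrA. Qed.
Let mulC : commutative mul.
Proof. by move=> f g; apply: functional_extensionality_dep => i; exact: mulrC. Qed.
Let mul1 : left_id (fun=> 1) mul.
Proof. by move=> f; apply: functional_extensionality_dep => i; exact: mul1r. Qed.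
Let mulD : left_distributive mul +%R.
Proof. by move=> f g h; apply: functional_extensionality_dep => i; exact: mulrDl. Qed.

HB.instance Definition _ := GRing.Zmodule_isComPzRing.Build P mulA mulC mul1 mulD.

Definition prodProj (i : I) (f : P) : R i := f i.

HB.instance Definition _ (i : I) :=
  GRing.isZmodMorphism.Build P (R i) (prodProj i) (fun _ _ => erefl).
HB.instance Definition _ (i : I) :=
  GRing.isMonoidMorphism.Build P (R i) (prodProj i)
    (conj erefl (fun _ _ => erefl)).

End ProdRing.

(* [idealr_closed] of ring_quotient.v is about proper ideals of nontrivial
   rings only, hence these definitions. *)
Definition ideal (R : comPzRingType) (J : set R) : Prop :=
  [/\ J 0, forall x y, J x -> J y -> J (x + y) & forall a x, J x -> J (a * x)].

Definition maximal_ideal (R : comPzRingType) (M : set R) : Prop :=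
  [/\ ideal M, M <> setT &
      forall J : set R, ideal J -> M `<=` J -> J = M \/ J = setT].

Lemma maximal_idealM (R : comPzRingType) (M : set R) (x y : R) :
  maximal_ideal M -> M (x * y) -> M x \/ M y.
Proof.
move=> [[M0 MD MM] _ Mmax] Mxy; have [Mx|Mx] := pselect (M x); first by left.
right; pose J := [set z | exists2 m, M m & exists a, z = m + a * x].
have sMJ : M `<=` J by move=> m Mm; exists m => //; exists 0; rewrite mul0r addr0.
have Jx : J x by exists 0 => //; exists 1; rewrite mul1r add0r.
have J_ideal : ideal J.
  split; first exact: sMJ.
    move=> _ _ [m Mm [a ->]] [n Mn [b ->]]; exists (m + n); first exact: MD.
    by exists (a + b); rewrite mulrDl addrACA.
  move=> c _ [m Mm [a ->]]; exists (c * m); first exact: MM.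
  by exists (c * a); rewrite mulrDr mulrA.
have [JM|JT] := Mmax J J_ideal sMJ; first by rewrite JM in Jx.
have [m Mm [a e]] : J 1 by rewrite JT.
by rewrite -[y]mulr1 e mulrDr mulrCA [y * x]mulrC; apply: MD; exact: MM.
Qed.

Record Max (R : comPzRingType) : Type := MkMax {
  max_set :> set R;
  max_setP : maximal_ideal max_set
}.

Lemma max_set_inj (R : comPzRingType) : injective (@max_set R).
Proof.
move=> [M Mp] [N Np] /= e; case: _ / e Np => Np.
by rewrite (Prop_irrelevance Mp Np).
Qed.

HB.instance Definition _ (R : comPzRingType) := gen_eqMixin (Max R).
HB.instance Definition _ (R : comPzRingType) := gen_choiceMixin (Max R).

Section Zariski.
Context (R : comPzRingType).

Definition hull (S : set R) : set (Max R) := [set M : Max R | S `<=` M].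

Definition zariski_open : set_system (Max R) :=
  [set U | exists S, ~` U = hull S].

Let zariskiT : zariski_open setT.
Proof.
exists setT; rewrite setCT; apply/seteqP; split=> // M TM.
by have [_ MT _] := max_setP M; apply: MT; apply/seteqP; split.
Qed.

Let zariskiI : setI_closed zariski_open.
Proof.
move=> U V [S US] [T VT]; exists [set x * y | x in S & y in T].
rewrite setCI US VT; apply/seteqP; split=> [M [SM|TM] _ [x Sx [y Ty <-]]|M STM].
- have [[_ _ MM] _ _] := max_setP M.
  by rewrite mulrC; apply: MM; exact: SM.
- by have [[_ _ MM] _ _] := max_setP M; apply: MM; exact: TM.
have [SM|/nonsubset[x [Sx nMx]]] := pselect (S `<=` M); first by left.
right=> y Ty; have : (M : set R) (x * y) by apply: STM; exists x => //; exists y.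
by case/(maximal_idealM (max_setP M)).
Qed.

Let zariski_bigU (I : Type) (U : I -> set (Max R)) :
  (forall i, zariski_open (U i)) -> zariski_open (\bigcup_i U i).
Proof.
move=> /choice[S US]; exists (\bigcup_i S i); rewrite setC_bigcup.
apply/seteqP; split=> [M UM x [i _ Six]|M SM i _].
  by have := UM i Logic.I; rewrite US; apply.
by rewrite US => x Six; apply: SM; exists i.
Qed.

HB.instance Definition _ :=
  isOpenTopological.Build (Max R) zariskiT zariskiI zariski_bigU.

Lemma zariski_closedP (C : set (Max R)) :
  closed C <-> exists S : set R, C = hull S.
Proof.
rewrite -openC; change (zariski_open (~` C) <-> exists S, C = hull S).
by rewrite /zariski_open /= setCK.
Qed.

End Zariski.

Definition homeomorphic (X Y : topologicalType) : Prop :=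
  exists (f : X -> Y) (g : Y -> X),
    [/\ cancel f g, cancel g f, continuous f & continuous g].

Definition pullbackMax (I : Type) (R : I -> comPzRingType) (i : I) :
    set (set (prodRing R)) :=
  [set prodProj i @^-1` M | M in [set M : set (R i) | maximal_ideal M]].
Arguments pullbackMax {I} R i.

(* Main.v *)
Require Import Defs.
From mathcomp Require Import all_boot all_order all_algebra.
From mathcomp Require Import all_classical topology.

(** Each projection of a product is a surjective ring morphism, and the theorem
is a fact about any surjective ring morphism [p : A -> B] with kernel [K].
By the correspondence theorem, taking preimages and taking images are inverse
bijections between the ideals of [B] and the ideals of [A] that contain [K].
Both preserve inclusions and proper ideals, hence maximality
([maximal_ideal_preimage], [maximal_ideal_image]). So the preimages of the
maximal ideals of [B] are the maximal ideals of [A] that contain [K]: they form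
the hull of [K], which is closed by definition ([pullback_hull]).

The bijection is a homeomorphism ([surj_rmorph_Max_homeo]) because each
direction pulls hulls back to hulls: the preimage of [M] contains [S] exactly
when [M] contains the image of [S], and, when [N] contains [K], the image of
[N] contains [T] exactly when [N] contains the preimage of [T]. *)

Import GRing.Theory.
Local Open Scope classical_set_scope.
Local Open Scope ring_scope.

Lemma ideal_preimage (A B : comPzRingType) (p : {rmorphism A -> B})
  (J : set B) : ideal J -> ideal (p @^-1` J).
Proof.
move=> [J0 JD JM]; split; rewrite /preimage/=.
- by rewrite rmorph0.
- by move=> x y Jx Jy; rewrite rmorphD; exact: JD.
- by move=> a x Jx; rewrite rmorphM; exact: JM.
Qed.

Section SurjectiveMorphism.
Context (A B : comPzRingType) (p : {rmorphism A -> B}).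
Hypothesis p_surj : range p = setT.
Local Notation K := (p @^-1` [set 0]).

Lemma ideal_image (J : set A) : ideal J -> ideal (p @` J).
Proof.
move=> [J0 JD JM]; split.
- by exists 0 => //; exact: rmorph0.
- move=> _ _ [x Jx <-] [y Jy <-].
  by exists (x + y); [exact: JD | exact: rmorphD].
- move=> b _ [x Jx <-]; have [a _ <-] : range p b by rewrite p_surj.
  by exists (a * x); [exact: JM | exact: rmorphM].
Qed.

(** If [p a = p x] with [x] in [N], then [a - x] is in the kernel, hence in
[N]. *)
Lemma preimage_image_ideal (N : set A) :
  ideal N -> K `<=` N -> p @^-1` (p @` N) = N.
Proof.
move=> [_ ND _] KN; apply/seteqP; split=> [a [x Nx pxa]|a Na]; last by exists a.
rewrite -(subrK x a); apply: ND => //; apply: KN.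
by rewrite /preimage/= rmorphB pxa subrr.
Qed.

Lemma ker_sub_preimage (J : set B) : ideal J -> K `<=` p @^-1` J.
Proof. by move=> [J0 _ _] a; rewrite /preimage/= => ->. Qed.

(** An ideal above the preimage of [M] contains the kernel, so it is the
preimage of its image, and maximality of [M] applies to that image. *)
Lemma maximal_ideal_preimage (M : set B) :
  maximal_ideal M -> maximal_ideal (p @^-1` M).
Proof.
move=> [Mi MT Mmax]; split; first exact: ideal_preimage.
- move=> pMT; apply: MT; rewrite -(image_preimage M p_surj) pMT.
  exact: p_surj.
- move=> J Ji MJ.
  have KJ : K `<=` J by apply: subset_trans MJ; exact: ker_sub_preimage.
  rewrite -(preimage_image_ideal J Ji KJ).
  have [||->|->] := Mmax (p @` J); [exact: ideal_image| |by left|by right].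
  by rewrite -[X in X `<=` _](image_preimage M p_surj); exact: image_subset.
Qed.

Lemma maximal_ideal_image (N : set A) :
  maximal_ideal N -> K `<=` N -> maximal_ideal (p @` N).
Proof.
move=> [Ni NT Nmax] KN; split; first exact: ideal_image.
- by move=> pNT; apply: NT; rewrite -(preimage_image_ideal N Ni KN) pNT.
- move=> J Ji NJ; rewrite -(image_preimage J p_surj).
  have [||->|->] := Nmax (p @^-1` J); [exact: ideal_preimage| |by left|].
  + by move=> a Na; apply: NJ; exists a.
  + by right; exact: p_surj.
Qed.

Lemma pullback_hull :
  @max_set A @^-1` [set p @^-1` M | M in [set M : set B | maximal_ideal M]]
  = hull K.
Proof.
apply/seteqP; split=> [N [M [Mi _ _] MN]|N KN] /=.
  by rewrite /hull/= -MN; exact: ker_sub_preimage.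
have NM := max_setP N; exists (p @` N); first exact: maximal_ideal_image.
by have [Ni _ _] := NM; exact: preimage_image_ideal.
Qed.

Lemma preimage_hullP (M : Max B) :
  hull K (MkMax (maximal_ideal_preimage M (max_setP M))).
Proof. by have [Mi _ _] := max_setP M; exact: ker_sub_preimage. Qed.

Definition Max_preimage (M : Max B) : hull K :=
  exist _ (MkMax (maximal_ideal_preimage M (max_setP M)))
    (mem_set (preimage_hullP M)).

Definition Max_image (N : hull K) : Max B :=
  MkMax (maximal_ideal_image (val N) (max_setP (val N)) (set_mem (valP N))).

Lemma Max_preimageK : cancel Max_preimage Max_image.
Proof. by move=> M; apply: max_set_inj; exact: image_preimage. Qed.

Lemma Max_imageK : cancel Max_image Max_preimage.
Proof.
move=> N; apply: val_inj; apply: max_set_inj => /=.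
have [Ni _ _] := max_setP (val N).
exact: preimage_image_ideal (set_mem (valP N)).
Qed.

Lemma Max_preimage_continuous : continuous Max_preimage.
Proof.
apply: continuous_comp_initial; apply/continuous_closedP => C.
move=> /zariski_closedP[S ->]; apply/zariski_closedP; exists (p @` S).
apply/seteqP; split=> [M SM _ [x Sx <-]|M SM x Sx]; first exact: SM.
by apply: SM; exists x.
Qed.

(** A closed subset of the subspace [hull K] is the trace of a closed subset of
[Max A], so the hull of the preimage of [T] has to be restricted to [hull K]. *)
Lemma Max_image_continuous : continuous Max_image.
Proof.
apply/continuous_closedP => C /zariski_closedP[T ->].
have -> : Max_image @^-1` hull T = set_val @^-1` hull (p @^-1` T).
  apply/seteqP; split=> N TN.
    move=> a Ta; have [Ni _ _] := max_setP (val N).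
    rewrite -(preimage_image_ideal _ Ni (set_mem (valP N))).
    exact: TN.
  move=> b Tb; have [a _ pab] : range p b by rewrite p_surj.
  by exists a => //; apply: TN; rewrite /preimage/= pab.
apply: preimage_closed; last by apply/zariski_closedP; exists (p @^-1` T).
by move=> N _; exact: initial_continuous.
Qed.

Lemma surj_rmorph_Max_homeo : homeomorphic (Max B) (hull K).
Proof.
exists Max_preimage, Max_image; split.
- exact: Max_preimageK.
- exact: Max_imageK.
- exact: Max_preimage_continuous.
- exact: Max_image_continuous.
Qed.

End SurjectiveMorphism.

(** An element of the [i]-th factor lifts to the family that vanishes at all
other indices. *)
Lemma prodProj_surj (I : Type) (R : I -> comPzRingType) (i : I) :
  range (@prodProj I R i) = setT.
Proof.
apply/seteqP; split=> // b _.
exists (@dfwith {classic I} R (fun=> 0) i b) => //.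
exact: (@dfwithin {classic I}).
Qed.

Theorem theorem4p8 (I : Type) (R : I -> comPzRingType) (i : I) :
  let Mi : set (Max (prodRing R)) := @max_set (prodRing R) @^-1` pullbackMax R i in
  [/\ pullbackMax R i `<=` [set N | maximal_ideal N],
      closed Mi &
      homeomorphic (Max (R i)) Mi].
Proof.
have surj := prodProj_surj I R i.
rewrite /= (pullback_hull _ _ _ surj); split.
- by move=> _ [M Mmax <-]; exact: maximal_ideal_preimage.
- by apply/zariski_closedP; eexists.
- exact: surj_rmorph_Max_homeo.
Qed.
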